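(* Let $\varphi$ be an index function and let $\Theta(u)=\sqrt u\,\varphi(u)$, $u>0$, such that the function $u\mapsto\varphi^2\left((\Theta^2)^{-1}(u)\right)$ is concave. Let $\alpha,\beta\in(0,1)$ and let $\Phi_\alpha$ be a level-$\alpha$ test for the direct problem $H_0^D\colon Tf=0$ with uniform separation rate $\rho^D(\Phi_\alpha,\mathcal E_\Theta,\beta)$. Then $\Phi_\alpha$ constitutes a level-$\alpha$ test for the inverse problem $H_0^I\colon f=0$ with uniform separation rate $$\rho^I(\Phi_\alpha,\mathcal E_\varphi,\beta)\le\varphi\left(\Theta^{-1}\left(\rho^D(\Phi_\alpha,\mathcal E_\Theta,\beta)\right)\right).$$ Consequently, the minimax separation rates satisfy $$\rho^I(\mathcal E_\varphi,\alpha,\beta)\le\varphi\left(\Theta^{-1}\left(\rho^D(\mathcal E_\Theta,\alpha,\beta)\right)\right).$$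
   Context: $H,K$ are separable Hilbert spaces, $T\colon H\to K$ is a compact linear operator, $\sigma>0$, and for $f\in H$ one observes $Y=Tf+\sigma\xi$, where $\xi$ is Gaussian white noise on $K$: for each $g\in K$ one observes $\langle Y,g\rangle=\langle Tf,g\rangle+\sigma\langle\xi,g\rangle$ with $\langle\xi,g\rangle\sim\mathcal N(0,\|g\|^2)$ and $\mathbb E[\langle\xi,g_1\rangle\langle\xi,g_2\rangle]=\langle g_1,g_2\rangle$. $P_f$ is the law of the data when the signal is $f$. A test is a measurable $\{0,1\}$-valued function of the data (value $1$ means rejection); it has level $\alpha$ if the probability of value $1$ is at most $\alpha$ under the null hypothesis. An index function is a continuous non-decreasing $\varphi\colon[0,\infty)\to[0,\infty)$ with $\varphi(0)=0$; here $\varphi(u)>0$ for $u>0$, so that $\Theta$ (with $\Theta(0)=0$) is strictly increasing and invertible. Source sets: $\mathcal E_\varphi=\{\varphi(T^*T)\omega:\ \omega\in H,\|\omega\|\le1\}\subset H$, and $\mathcal E_\Theta=\{\Theta(TT^* )w:\ w\in K,\|w\|\le1\}\subset K$, which describes the smoothness of $Tf$; $f\in\mathcal E_\varphi$ implies $Tf\in\mathcal E_\Theta$. The inverse problem tests $f=0$ against $f\in\mathcal E_\varphi$, $\|f\|\ge\rho^I$; the direct problem tests $Tf=0$ against $Tf\in\mathcal E_\Theta$, $\|Tf\|\ge\rho^D$. Uniform separation rates: $\rho^I(\Phi,\mathcal E_\varphi,\beta)=\inf\{\rho\ge0:\sup_{f\in\mathcal E_\varphi,\|f\|>\rho}P_f(\Phi=0)\le\beta\}$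 and $\rho^D(\Phi,\mathcal E_\Theta,\beta)=\inf\{\rho\ge0:\sup_{f:\,Tf\in\mathcal E_\Theta,\|Tf\|>\rho}P_f(\Phi=0)\le\beta\}$ (supremum over the empty set is $0$). The minimax rates $\rho^I(\mathcal E_\varphi,\alpha,\beta)$ and $\rho^D(\mathcal E_\Theta,\alpha,\beta)$ are the infima of these over all level-$\alpha$ tests of the respective problem. *)

(* Defs.v *)
From HB Require Import structures.
From mathcomp Require Import all_boot all_order all_algebra.
From mathcomp Require Import all_classical all_reals all_analysis.

Set Implicit Arguments.
Unset Strict Implicit.
Unset Printing Implicit Defensive.

Import Order.TTheory GRing.Theory Num.Theory.
Import numFieldTopology.Exports numFieldNormedType.Exports.

Local Open Scope classical_set_scope.
Local Open Scope ring_scope.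

HB.mixin Record CompleteNormedModule_isHilbert (R : realType) H
    of CompleteNormedModule R H := {
  dot : H -> H -> R ;
  dotC : forall x y, dot x y = dot y x ;
  dot_linearl : forall (a : R) x y z, dot (a *: x + y) z = a * dot x z + dot y z ;
  dotxx : forall x, dot x x = `|x| ^+ 2
}.

#[short(type="hilbertType")]
HB.structure Definition Hilbert (R : realType) :=
  {H of CompleteNormedModule_isHilbert R H & CompleteNormedModule R H}.

Definition separable (T : topologicalType) : Prop :=
  exists2 D : set T, countable D & dense D.

Definition compact_operator (R : realType) (H K : hilbertType R)
    (T : {linear H -> K}) : Prop :=
  precompact (T @` [set x | `|x| <= 1]).

(* For bounded T the representing vector exists and is unique, by Riesz. *)
Definition adjoint (R : realType) (H K : hilbertType R) (T : H -> K) (g : K) : H :=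
  get [set h : H | forall f : H, dot (T f) g = dot f h].

(* A x = \sum_i lambda_i <x, e_i> e_i with (e_i) orthonormal. Vectors e_i = 0
   are allowed as padding, so that one sequence indexed by nat also serves
   operators of finite rank and finite-dimensional spaces; the scalar lambda_i
   is then irrelevant. *)
Definition spectral_decomposition (R : realType) (H : hilbertType R)
    (A : H -> H) (s : (nat -> R) * (nat -> H)) : Prop :=
  [/\ forall i, s.2 i = 0 \/ `|s.2 i| = 1,
      forall i j, i <> j -> dot (s.2 i) (s.2 j) = 0 &
      forall x, series (fun i => (s.1 i * dot x (s.2 i)) *: s.2 i) @ \oo --> A x].

(* phi(A) x = \sum_i phi(lambda_i) <x, e_i> e_i, for A compact, self-adjoint and
   nonnegative. The e_i need not span the kernel of A: since phi 0 = 0 the kernel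
   contributes nothing, and the result does not depend on the decomposition. *)
Definition spectral_calculus (R : realType) (H : hilbertType R)
    (phi : R -> R) (A : H -> H) (x : H) : H :=
  let s := get (spectral_decomposition A) in
  limn (series (fun i => (phi (s.1 i) * dot x (s.2 i)) *: s.2 i)).

Definition source_set (R : realType) (H : hilbertType R)
    (phi : R -> R) (A : H -> H) : set H :=
  spectral_calculus phi A @` [set w | `|w| <= 1].

(* Functions on [0, oo) are represented by functions on R; only their values on
   [0, oo) matter. *)
Definition index_function (R : realType) (phi : R -> R) : Prop :=
  [/\ {within `[0, +oo[, continuous phi},
      {in `[0, +oo[ &, {homo phi : u v / u <= v}},
      phi 0 = 0 &
      forall u, 0 < u -> 0 < phi u].

Definition Theta (R : realType) (phi : R -> R) (u : R) : R := Num.sqrt u * phi u.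

Definition inv_on_nonneg (R : realType) (F : R -> R) : R -> R :=
  'pinv_(fun=> 0) `[0, +oo[ F.

Definition concave_on_nonneg (R : realType) (F : R -> R) : Prop :=
  convex_function (E := R^o) `[0, +oo[ (fun u : R => - F u).

(* N(0, |g|^2); the library's normal_prob takes the standard deviation and is not
   a Dirac mass when it vanishes, hence the separate clause for g = 0. *)
Definition white_noise (R : realType) (K : hilbertType R)
    (d : measure_display) (Omega : measurableType d) (P : probability Omega R)
    (xi : K -> {RV P >-> R}) : Prop :=
  [/\ forall g, g <> 0 -> forall B : set R, measurable B ->
        distribution P (xi g) B = normal_prob 0 `|g| B,
      forall B : set R, measurable B -> distribution P (xi 0) B = \d_(0 : R) B &
      forall g1 g2 : K, ('E_P[xi g1 \* xi g2] = (dot g1 g2)%:E)%E].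

(* The data is the whole family (<Y, g>)_g, in R^K with the product sigma-algebra. *)
Definition cylinders (R : realType) (K : hilbertType R) : set (set (K -> R)) :=
  [set A | exists (g : K) (B : set R), measurable B /\ A = [set y | B (y g)]].

Definition data (R : realType) (K : hilbertType R) :=
  g_sigma_algebraType (@cylinders R K).

Section testing.
Context (R : realType) (H K : hilbertType R) (T : {linear H -> K}) (sigma : R)
  (d : measure_display) (Omega : measurableType d) (P : probability Omega R)
  (xi : K -> {RV P >-> R}).

Definition observation (f : H) (omega : Omega) : data K :=
  fun g : K => dot (T f) g + sigma * xi g omega.

Definition law (f : H) : set (data K) -> \bar R := pushforward P (observation f).

Definition test := {mfun data K >-> bool}.

Definition rejection_prob (Phi : test) (f : H) : R :=
  fine (law f [set y | Phi y = true]).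

Definition acceptance_prob (Phi : test) (f : H) : R :=
  fine (law f [set y | Phi y = false]).

Definition levelI (alpha : R) (Phi : test) : Prop :=
  forall f : H, f = 0 -> rejection_prob Phi f <= alpha.

Definition levelD (alpha : R) (Phi : test) : Prop :=
  forall f : H, T f = 0 -> rejection_prob Phi f <= alpha.

(* The library's sup is 0 on the empty set. *)
Definition rateI (E : set H) (beta : R) (Phi : test) : R :=
  inf [set rho | 0 <= rho /\
    sup [set acceptance_prob Phi f | f in [set f | E f /\ rho < `|f|]] <= beta].

Definition rateD (E : set K) (beta : R) (Phi : test) : R :=
  inf [set rho | 0 <= rho /\
    sup [set acceptance_prob Phi f | f in [set f | E (T f) /\ rho < `|T f|]]
      <= beta].

Definition minimaxI (E : set H) (alpha beta : R) : R :=
  inf [set rateI E beta Phi | Phi in levelI alpha].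

Definition minimaxD (E : set K) (alpha beta : R) : R :=
  inf [set rateD E beta Phi | Phi in levelD alpha].

End testing.

(* Main.v *)
Require Import Defs.
From HB Require Import structures.
From mathcomp Require Import all_boot all_order all_algebra.
From mathcomp Require Import all_classical all_reals all_analysis.
From mathcomp Require Import measurable_realfun ring lra.

Set Implicit Arguments.
Unset Strict Implicit.
Unset Printing Implicit Defensive.

Import Order.TTheory GRing.Theory Num.Theory.
Import numFieldTopology.Exports numFieldNormedType.Exports.

Local Open Scope classical_set_scope.
Local Open Scope ring_scope.

(** The data are the same in both problems, so a test of the direct problem can be
    read as a test of the inverse one.  What has to be shown is that a signal [f] in
    the source set that is long has a long image: with the smoothness modulus
    [G r = phi (Theta^-1 r)],
      [|f| <= G |T f|]   and   [T f] lies in the image source set.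
    A test that detects images longer than [rho] then detects signals longer than
    [G rho], since [G] is nondecreasing ([rateI_le_rateD]).  The minimax bound
    follows by taking the infimum over tests, because [G] is right continuous
    ([minimaxI_le_minimaxD]).

    Both facts about [f] are read off a singular value decomposition
    [T e_i = sigma_i g_i].  If [f = \sum_i phi(sigma_i^2) w_i e_i] with
    [\sum_i w_i^2 <= 1], then [T f = \sum_i Theta(sigma_i^2) w_i g_i] is in the
    image source set ([source_set_image]), and
      [|f|^2 = \sum_i w_i^2 phi(sigma_i^2)^2],
      [|T f|^2 = \sum_i w_i^2 Theta(sigma_i^2)^2].
    The concave function of the hypothesis maps [Theta(sigma^2)^2] to
    [phi(sigma^2)^2], so Jensen's inequality, with the missing mass placed at [0],
    bounds [|f|^2] by its value at [|T f|^2], which is [G |T f| ^ 2]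
    ([source_norm_le]).

    The source sets are defined through spectral decompositions of [T^* T] and of
    [T T^*] chosen independently of each other.  A decomposition of [T^* T] is
    transported to one of [T T^*] ([spectral_decomposition_swap]), and the calculus
    is shown not to depend on the decomposition ([calculus_unique]).  Should [T^* T]
    have no decomposition, its calculus is the zero map, its source set is [{0}],
    and both facts hold for [f = 0].  The adjoint is provided by the Riesz
    representation theorem ([riesz]). *)

(** * Geometry of Hilbert spaces *)

Section hilbert.
Context (R : realType) (H : hilbertType R).
Implicit Types (x y z : H) (a : R) (u : nat -> H).

(** The inner product with a fixed vector, in the form that inherits the lemmas
    on linear maps and can be fed to [riesz]. *)
Definition dotr (y x : H) : R^o := dot x y.

Lemma dotr_is_linear y : linear (dotr y).
Proof. by move=> a x z; rewrite /dotr dot_linearl. Qed.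

HB.instance Definition _ (y : H) :=
  GRing.isLinear.Build R H R^o *:%R (dotr y) (dotr_is_linear y).

Lemma dot0l y : dot 0 y = 0 :> R.
Proof. exact: (linear0 (dotr y)). Qed.

Lemma dotDl x y z : dot (x + y) z = dot x z + dot y z :> R.
Proof. exact: (linearD (dotr z)). Qed.

Lemma dotBl x y z : dot (x - y) z = dot x z - dot y z :> R.
Proof. exact: (linearB (dotr z)). Qed.

Lemma dotZl a x y : dot (a *: x) y = a * dot x y :> R.
Proof. exact: (linearZ_LR (dotr y)). Qed.

Lemma dot0r x : dot x 0 = 0 :> R.
Proof. by rewrite dotC dot0l. Qed.

Lemma dotDr x y z : dot x (y + z) = dot x y + dot x z :> R.
Proof. by rewrite dotC dotDl !(dotC x). Qed.

Lemma dotBr x y z : dot x (y - z) = dot x y - dot x z :> R.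
Proof. by rewrite dotC dotBl !(dotC x). Qed.

Lemma dotZr a x y : dot x (a *: y) = a * dot x y :> R.
Proof. by rewrite dotC dotZl (dotC x). Qed.

Lemma sqr_normD x y : `|x + y| ^+ 2 = `|x| ^+ 2 + 2 * dot x y + `|y| ^+ 2 :> R.
Proof. by rewrite -!dotxx !dotDl !dotDr (dotC y x); ring. Qed.

Lemma sqr_normB x y : `|x - y| ^+ 2 = `|x| ^+ 2 - 2 * dot x y + `|y| ^+ 2 :> R.
Proof. by rewrite -!dotxx !dotBl !dotBr (dotC y x); ring. Qed.

Lemma dotxx_eq0 x : dot x x = 0 :> R -> x = 0.
Proof. by rewrite dotxx => /eqP; rewrite sqrf_eq0 normr_eq0 => /eqP. Qed.

(** The squared norm of [|y|^2 x - (x.y) y], the component of [x] orthogonal to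
    [y] up to a factor, is nonnegative. *)
Lemma cauchy_schwarz x y : `|dot x y| <= `|x| * `|y| :> R.
Proof.
have [->|y0] := eqVneq y 0; first by rewrite dot0r !normr0 mulr0.
rewrite -ler_sqr ?nnegrE ?mulr_ge0//.
rewrite exprMn real_normK ?num_real//.
have y2 : 0 < `|y| ^+ 2 :> R by rewrite exprn_gt0 ?normr_gt0.
have : 0 <= `| (`|y| ^+ 2) *: x - dot x y *: y| ^+ 2 by rewrite sqr_ge0.
rewrite sqr_normB !normrZ dotZl dotZr !exprMn !real_normK ?num_real//.
rewrite -subr_ge0 => h; rewrite -subr_ge0 -(pmulr_rge0 _ y2).
by apply: le_trans h _; rewrite le_eqVlt; apply/orP; left; apply/eqP; ring.
Qed.

Lemma dot_le_norm x y : dot x y <= `|x| * `|y| :> R.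
Proof. by rewrite (le_trans (ler_norm _))// cauchy_schwarz. Qed.

Lemma bounded_continuous (K : normedModType R) (f : {linear H -> K}) (C : R) :
  (forall x, `|f x| <= C * `|x|) -> continuous f.
Proof.
move=> fC; apply: bounded_linear_continuous; apply/linear_boundedP.
by near=> r => x; rewrite (le_trans (fC x))// ler_wpM2r.
Unshelve. all: by end_near. Qed.

Lemma cvg_dotl y u x : u @ \oo --> x ->
  (fun n => dot (u n) y) @ \oo --> (dot x y : R).
Proof.
move=> ux; have dc : continuous (dotr y).
  by apply: (@bounded_continuous _ _ `|y|) => z; rewrite mulrC cauchy_schwarz.
exact: (cvg_comp _ _ ux (dc x)).
Qed.
#[global] Arguments cvg_dotl y {u x}.

Lemma cvg_norm_le u x (M : R) : u @ \oo --> x ->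
  (forall n, `|u n| <= M) -> `|x| <= M.
Proof.
by move=> /cvg_norm ux uM; apply: (cvgr_to_le ux); apply: nearW.
Qed.

(** A Cauchy criterion shaped for Hilbert spaces, where it is the squared
    distance of two terms that identities control. *)
Lemma cvg_of_sqr_dist u (b : R ^nat) : b @ \oo --> 0 ->
  (forall m n, `|u m - u n| ^+ 2 <= b m + b n) -> cvgn u.
Proof.
move=> b0 ub; apply/cauchy_cvgP/cauchy_ballP => e e0; near_simpl.
have bs : \forall n \near \oo, b n < e ^+ 2 / 2.
  by apply: cvgr_lt b0 _ _; rewrite divr_gt0 ?exprn_gt0.
exists ([set n | b n < e ^+ 2 / 2], [set n | b n < e ^+ 2 / 2]) => //.
move=> [m n] [/= bm bn].
rewrite -ball_normE/= -(@ltr_pXn2r _ 2) ?nnegrE ?normr_ge0 ?(ltW e0)//.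
by apply: le_lt_trans (ub _ _) _; rewrite (splitr (e ^+ 2)) ltrD.
Qed.

(** Riesz representation.  The representing vector minimises the energy
    [|x|^2 - 2 L x]: minimising sequences are Cauchy by the parallelogram
    identity, and at the minimiser the first variation in every direction
    vanishes. *)
Lemma riesz (L : {linear H -> R^o}) (C : R) :
  (forall x, `|L x| <= C * `|x|) -> exists h, forall x, L x = dot x h.
Proof.
move=> LC.
pose J x : R := `|x| ^+ 2 - 2 * L x.
have Jlb x : - C ^+ 2 <= J x.
  have h := le_trans (ler_norm _) (LC x).
  rewrite /J; have := sqr_ge0 (`|x| - C); nra.
pose m := inf (range J).
have hi : has_inf (range J).
  by split; [exists (J 0), 0|exists (- C ^+ 2) => _ [x _ <-]].
have mJ x : m <= J x by apply: ge_inf; [case: hi|exists x].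
(* Parallelogram identity: near-minimisers are close, as J at their midpoint
   is still at least m. *)
have mid x y : `|x - y| ^+ 2 <= 2 * (J x - m) + 2 * (J y - m).
  have := mJ (2^-1 *: (x + y)); rewrite /J.
  rewrite normrZ exprMn sqr_normB sqr_normD real_normK ?num_real//.
  rewrite (linearZ_LR L) (linearD L) -[_ *: _]/(_ * _).
  set X := `|x| ^+ 2; set Y := `|y| ^+ 2; set D := dot x y.
  set A := L x; set B := L y.
  lra.
have /choice[u uJ] : forall n : nat, exists x, J x < m + n.+1%:R^-1.
  move=> n; have [|_ [x _ <-] xm] := @inf_adherent _ (range J) n.+1%:R^-1 _ hi.
    by rewrite invr_gt0.
  by exists x.
have cu : cvgn u.
  apply: (@cvg_of_sqr_dist _ (fun n => 2 * n.+1%:R^-1)) => [|n k].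
    rewrite -[X in _ --> X](mulr0 2).
    by apply: cvgM; [exact: cvg_cst|exact: cvg_harmonic].
  apply: le_trans (mid _ _) _; apply: lerD; rewrite ler_pM2l//;
    by rewrite lerBlDl ltW.
set h := limn u.
have Jh : J h <= m.
  have Ju : (fun n => J (u n)) @ \oo --> (J h : R).
    apply: cvgB.
      rewrite expr2; under eq_fun do rewrite expr2.
      by apply: cvgM; apply: cvg_norm; exact: cu.
    apply: cvgM; first exact: cvg_cst.
    exact: (cvg_comp _ _ cu (@bounded_continuous _ L _ LC h)).
  have mh : (fun n => m + n.+1%:R^-1) @ \oo --> m + 0.
    by apply: cvgD; [exact: cvg_cst|exact: cvg_harmonic].
  rewrite -[leRHS]addr0; apply: (ler_cvg_to Ju mh).
  by near=> n; exact/ltW/uJ.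
exists h => x; apply/eqP; rewrite -subr_eq0; apply/eqP.
set c := L x - _.
have key t : 2 * t * c <= t ^+ 2 * `|x| ^+ 2.
  have := le_trans Jh (mJ (h + t *: x)).
  rewrite /J sqr_normD normrZ exprMn real_normK ?num_real//.
  rewrite (linearD L) (linearZ_LR L).
  rewrite -[t *: L x]/(t * L x) dotZr /c (dotC x h); lra.
(* The + 1 keeps the step defined when x = 0. *)
have := key (c / (`|x| ^+ 2 + 1)).
set q := `|x| ^+ 2; have q0 : 0 <= q by rewrite sqr_ge0.
rewrite -subr_ge0 => h0.
suff : c ^+ 2 <= 0 by move=> c2; apply/eqP; rewrite -sqrf_eq0 eq_le c2 sqr_ge0.
have : 0 <= - (c ^+ 2 * ((q + 2) / (q + 1) ^+ 2)).
  apply: le_trans h0 _; rewrite le_eqVlt; apply/orP; left; apply/eqP.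
  by field; rewrite gt_eqF// ltr_wpDl.
by rewrite oppr_ge0 pmulr_lle0// divr_gt0 ?exprn_gt0 ?ltr_wpDl.
Unshelve. all: by end_near. Qed.

(** Zero vectors are allowed, as in spectral decompositions; identities then carry
    a factor [|e i|^2], which [dot_orthE] absorbs into Fourier coefficients. *)
Definition orthonormal0 (e : nat -> H) :=
  (forall i, e i = 0 \/ `|e i| = 1 :> R) /\
  (forall i j, i <> j -> dot (e i) (e j) = 0 :> R).

Section orthonormal.
Context (e : nat -> H) (one : orthonormal0 e).
Implicit Types c : nat -> R.

Lemma dot_orth_sum c (m n j : nat) : dot (\sum_(m <= i < n) c i *: e i) (e j) =
  (if (m <= j < n)%N then c j * `|e j| ^+ 2 else 0) :> R.
Proof.
rewrite -[LHS]/(dotr (e j) _) linear_sum/= /dotr.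
under eq_bigr do rewrite dotZl.
case: ifPn => [jn|jn].
  rewrite (bigD1_seq j) ?mem_index_iota ?iota_uniq//= dotxx big1 ?addr0//.
  by move=> i /eqP ij; rewrite one.2// mulr0.
rewrite big_nat big1// => i imn; rewrite one.2 ?mulr0// => ij.
by move: jn; rewrite -ij imn.
Qed.

Lemma sqr_norm_orth_sum c (m n : nat) :
  `|\sum_(m <= i < n) c i *: e i| ^+ 2 =
  \sum_(m <= i < n) c i ^+ 2 * `|e i| ^+ 2 :> R.
Proof.
rewrite -dotxx -[LHS]/(dotr _ _) linear_sum/= /dotr.
apply: eq_big_nat => i imn.
by rewrite dotZl dotC dot_orth_sum imn; ring.
Qed.

Lemma dot_orthE x i : dot x (e i) * `|e i| ^+ 2 = dot x (e i) :> R.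
Proof.
by case: (one.1 i) => ->; rewrite ?dot0r ?mul0r// expr1n mulr1.
Qed.

Lemma bessel x n : \sum_(0 <= i < n) (dot x (e i)) ^+ 2 <= `|x| ^+ 2 :> R.
Proof.
set S := \sum_(0 <= i < n) dot x (e i) *: e i.
have sq : `|S| ^+ 2 = \sum_(0 <= i < n) (dot x (e i)) ^+ 2 :> R.
  rewrite sqr_norm_orth_sum; apply: eq_bigr => i _.
  by rewrite expr2 -mulrA dot_orthE.
have xS : dot x S = `|S| ^+ 2 :> R.
  rewrite sq dotC -[LHS]/(dotr _ _) linear_sum/= /dotr.
  by apply: eq_bigr => i _; rewrite dotZl (dotC _ x) expr2.
have := sqr_ge0 `|x - S|; rewrite sqr_normB xS -sq; lra.
Qed.

(** Riesz-Fischer: by orthogonality the increments of the vector series are the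
    increments of a convergent real series. *)
Lemma cvg_orth_series c (M : R) :
  (forall n, \sum_(0 <= i < n) c i ^+ 2 * `|e i| ^+ 2 <= M) ->
  cvgn (series (fun i => c i *: e i)).
Proof.
move=> cM; pose s : R ^nat := series (fun i => c i ^+ 2 * `|e i| ^+ 2).
have cs : cvgn s.
  apply: nondecreasing_is_cvgn; last by exists M => _ [n _ <-]; exact: cM.
  by apply: nondecreasing_series => n _ _; rewrite mulr_ge0 ?sqr_ge0.
apply: (@cvg_of_sqr_dist _ (fun n => `|s n - limn s|)) => [|m n].
  rewrite -(@normr0 _ R) -(subrr (limn s)); apply: cvg_norm.
  by apply: cvgB; [exact: cs|exact: cvg_cst].
wlog mn : m n / (m <= n)%N => [W|].
  have [/W//|/ltnW nm] := leqP m n.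
  by rewrite distrC [leRHS]addrC; exact: W.
rewrite distrC (sub_series_geq _ mn) sqr_norm_orth_sum.
have -> : \sum_(m <= i < n) c i ^+ 2 * `|e i| ^+ 2 = s n - s m.
  by rewrite (sub_series_geq _ mn).
have -> : s n - s m = (s n - limn s) - (s m - limn s) by ring.
rewrite (le_trans (ler_norm _))//.
by rewrite (le_trans (ler_normB _ _))// addrC.
Qed.

Lemma dot_orth_lim c x j : series (fun i => c i *: e i) @ \oo --> x ->
  dot x (e j) = c j * `|e j| ^+ 2 :> R.
Proof.
move=> /(cvg_dotl (e j)) sx; apply: (cvg_unique _ sx) => //.
apply: cvg_near_cst; near=> n; rewrite dot_orth_sum leq0n/=.
by rewrite ifT//; near: n; exact: nbhs_infty_gt.
Unshelve. all: by end_near. Qed.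

End orthonormal.

End hilbert.

(** * Spectral calculus *)

Section spectral_calculus.
Context (R : realType) (H : hilbertType R) (A : H -> H).
Implicit Types (s t : (nat -> R) * (nat -> H)) (psi : R -> R) (x y z : H).

Definition calculus_series psi s x : nat -> H :=
  series (fun i => (psi (s.1 i) * dot x (s.2 i)) *: s.2 i).

Lemma spectral_orthonormal0 s : spectral_decomposition A s -> orthonormal0 s.2.
Proof. by case. Qed.

Lemma spectral_dot s x j : spectral_decomposition A s ->
  dot (A x) (s.2 j) = s.1 j * dot x (s.2 j) :> R.
Proof.
move=> ds; have os := spectral_orthonormal0 ds; case: ds => _ _ /(_ x) cA.
by rewrite (dot_orth_lim os j cA) -mulrA dot_orthE.
Qed.

Lemma spectral_eigen s i : spectral_decomposition A s -> A (s.2 i) = s.1 i *: s.2 i.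
Proof.
move=> ds; have os := spectral_orthonormal0 ds; case: ds => _ _ /(_ (s.2 i)) cA.
apply: (cvg_unique _ cA) => //; apply: cvg_near_cst; near=> n.
rewrite /series/= (bigD1_seq i) ?iota_uniq//=; last first.
  by rewrite mem_index_iota leq0n/=; near: n; exact: nbhs_infty_gt.
rewrite big1 ?addr0 => [|k /eqP ki]; last first.
  by rewrite os.2 ?mulr0 ?scale0r//; exact/nesym.
by case: (os.1 i) => h; rewrite dotxx h ?scaler0// expr1n mulr1.
Unshelve. all: by end_near. Qed.

(** The Fourier coefficients of a functional calculus computed from [s] against
    the eigenvectors of another decomposition [t].  Where [s.2 i] and [t.2 j] are
    not orthogonal their eigenvalues agree, so that, term by term, the series of
    [psi(A) x] is [psi mu / mu] times the series of [A x], with [mu = t.1 j]; when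
    [mu = 0] both vanish because [psi 0 = 0]. *)
Lemma calculus_dot psi s t x (u : H) j : psi 0 = 0 ->
  spectral_decomposition A s -> spectral_decomposition A t ->
  calculus_series psi s x @ \oo --> u ->
  dot u (t.2 j) = psi (t.1 j) * dot x (t.2 j) :> R.
Proof.
move=> psi0 ds dt su; set r : R := psi (t.1 j) / t.1 j.
have rE : r * t.1 j = psi (t.1 j).
  rewrite /r; have [->|t0] := eqVneq (t.1 j) 0; last by rewrite divfK.
  by rewrite psi0 mulr0.
have term i : psi (s.1 i) * dot (s.2 i) (t.2 j) = r * (s.1 i * dot (s.2 i) (t.2 j)).
  have st : s.1 i * dot (s.2 i) (t.2 j) = t.1 j * dot (s.2 i) (t.2 j) :> R.
    by rewrite -spectral_dot// (spectral_eigen _ ds) dotZl.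
  rewrite st mulrA rE.
  have [->|d0] := eqVneq (dot (s.2 i) (t.2 j) : R) 0; first by rewrite !mulr0.
  by rewrite (mulIf d0 st).
have cA : series (fun i => (s.1 i * dot x (s.2 i)) *: s.2 i) @ \oo --> A x.
  by case: ds.
rewrite -rE -mulrA -(spectral_dot _ _ dt).
apply: (cvg_unique _ (cvg_dotl (t.2 j) su)) => //.
rewrite (_ : (fun n => _) = (fun n => r *
    dot (series (fun i => (s.1 i * dot x (s.2 i)) *: s.2 i) n) (t.2 j))).
  exact: (cvgM (cvg_cst r) (cvg_dotl (t.2 j) cA)).
apply/funext => n.
rewrite -2![dot _ (t.2 j)]/(dotr _ _) !linear_sum/= mulr_sumr /dotr.
apply: eq_bigr => i _; rewrite !dotZl.
by rewrite mulrAC term; ring.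
Qed.

Lemma calculus_lim_orth psi s x (u : H) z : calculus_series psi s x @ \oo --> u ->
  (forall i, dot z (s.2 i) = 0 :> R) -> dot u z = 0 :> R.
Proof.
move=> su z0; apply: (cvg_unique _ (cvg_dotl z su)) => //.
apply: cvg_near_cst; apply: nearW => n.
rewrite -[LHS]/(dotr _ _) linear_sum/= /dotr big1// => i _.
by rewrite dotZl (dotC (s.2 i)) z0 mulr0.
Qed.

(** The calculus does not depend on the decomposition: by [calculus_dot] the
    difference of the two sums is orthogonal to both families of eigenvectors,
    hence to both sums and to itself. *)
Lemma calculus_unique psi s t x (u v : H) : psi 0 = 0 ->
  spectral_decomposition A s -> spectral_decomposition A t ->
  calculus_series psi s x @ \oo --> u -> calculus_series psi t x @ \oo --> v ->
  u = v.
Proof.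
move=> psi0 ds dt su tv; apply/eqP; rewrite -subr_eq0; apply/eqP/dotxx_eq0.
rewrite {1}dotBl (calculus_lim_orth su) ?(calculus_lim_orth tv) ?subrr// => i;
  by rewrite dotBl (calculus_dot _ psi0 ds _ su)// (calculus_dot _ psi0 dt _ tv)//
    subrr.
Qed.

(** Without any decomposition, [get] returns a default pair whose eigenvalues
    are all [0], and [psi 0 = 0] annihilates the series. *)
Lemma spectral_calculus_default psi x : psi 0 = 0 ->
  ~ (exists s, spectral_decomposition A s) -> spectral_calculus psi A x = 0.
Proof.
move=> psi0 nd; rewrite /spectral_calculus /= xgetPN => [|s ds]; last first.
  by apply: nd; exists s.
apply: cvg_lim => //; apply: cvg_near_cst; apply: nearW => n.
rewrite /series/= big1// => i _.
by rewrite -[X in psi X]/(0 : R) psi0 mul0r scale0r.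
Qed.

Lemma spectral_calculus0 psi : spectral_calculus psi A 0 = 0.
Proof.
apply: cvg_lim => //; apply: cvg_near_cst; apply: nearW => n.
by rewrite /series/= big1// => i _; rewrite dot0l mulr0 scale0r.
Qed.

(** From here on the quadratic form of [A] lies between [0] and [C], hence so do
    the eigenvalues, and [psi C] bounds the coefficients of [psi(A)]. *)
Section bounded.
Context (C : R) (C0 : 0 <= C) (AC : forall x, 0 <= dot (A x) x <= C * `|x| ^+ 2).
Context (psi : R -> R) (psi0 : psi 0 = 0)
  (psi_homo : {in `[0, +oo[ &, {homo psi : u v / u <= v}}).

Lemma nondecreasing0_ge0 u : 0 <= u -> 0 <= psi u.
Proof. by move=> u0; rewrite -psi0 psi_homo// in_itv/= andbT. Qed.

Lemma eigenvalue_itv s i : spectral_decomposition A s -> s.2 i <> 0 ->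
  0 <= s.1 i <= C.
Proof.
move=> ds si; have := AC (s.2 i); rewrite (spectral_eigen _ ds) dotZl dotxx.
by case: ((spectral_orthonormal0 ds).1 i) => // ->; rewrite expr1n !mulr1.
Qed.

Lemma calculus_series_norm s x n : spectral_decomposition A s ->
  \sum_(0 <= i < n) (psi (s.1 i) * dot x (s.2 i)) ^+ 2 * `|s.2 i| ^+ 2
    <= (psi C * `|x|) ^+ 2.
Proof.
move=> ds; have os := spectral_orthonormal0 ds.
apply: (@le_trans _ _ (\sum_(0 <= i < n) psi C ^+ 2 * dot x (s.2 i) ^+ 2)).
  apply: ler_sum => i _; case: (os.1 i) => si.
    by rewrite si normr0 expr0n/= mulr0 mulr_ge0 ?sqr_ge0.
  rewrite si expr1n mulr1 exprMn ler_wpM2r ?sqr_ge0//.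
  have /andP[l0 lC] : 0 <= s.1 i <= C.
    apply: eigenvalue_itv => // s0; move: si; rewrite s0 normr0 => /eqP.
    by rewrite eq_sym oner_eq0.
  rewrite ler_sqr ?nnegrE ?nondecreasing0_ge0//.
  by apply: psi_homo; rewrite ?in_itv/= ?andbT.
by rewrite -mulr_sumr exprMn ler_wpM2l ?sqr_ge0 ?bessel.
Qed.

Lemma calculus_series_cvg s x : spectral_decomposition A s ->
  cvgn (calculus_series psi s x).
Proof.
move=> ds; apply: (cvg_orth_series (spectral_orthonormal0 ds)) => n.
exact: calculus_series_norm.
Qed.

Lemma spectral_calculusE s x (u : H) : spectral_decomposition A s ->
  calculus_series psi s x @ \oo --> u -> spectral_calculus psi A x = u.
Proof.
move=> ds su; have dg : spectral_decomposition A (get (spectral_decomposition A)).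
  by apply: getPex; exists s.
exact: (calculus_unique psi0 dg ds (calculus_series_cvg dg) su).
Qed.

Lemma source_set_bounded y : source_set psi A y -> `|y| <= psi C.
Proof.
move=> [x /= x1 <-].
have [[s ds]|nd] := pselect (exists s, spectral_decomposition A s); last first.
  by rewrite spectral_calculus_default// normr0 nondecreasing0_ge0.
rewrite (spectral_calculusE ds (calculus_series_cvg ds)).
apply: (cvg_norm_le (calculus_series_cvg ds)) => n.
rewrite -ler_sqr ?nnegrE ?nondecreasing0_ge0//.
rewrite (sqr_norm_orth_sum (spectral_orthonormal0 ds)).
apply: le_trans (calculus_series_norm _ _ ds) _.
by rewrite ler_sqr ?nnegrE ?mulr_ge0 ?nondecreasing0_ge0// ler_piMr
  ?nondecreasing0_ge0.
Qed.

End bounded.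
End spectral_calculus.

(** * Adjoint and singular value decomposition *)

Lemma Theta_nondecreasing (R : realType) (phi : R -> R) : phi 0 = 0 ->
  {in `[0, +oo[ &, {homo phi : u v / u <= v}} ->
  {in `[0, +oo[ &, {homo Theta phi : u v / u <= v}}.
Proof.
move=> phi0 phi_homo u v u0 v0 uv.
apply: ler_pM; rewrite ?sqrtr_ge0 ?ler_wsqrtr ?phi_homo//.
by apply: (nondecreasing0_ge0 phi0 phi_homo); move: u0; rewrite in_itv/= andbT.
Qed.

Section compact_operator.
Context (R : realType) (H K : hilbertType R) (T : {linear H -> K}).

Lemma compact_operator_bounded : compact_operator T ->
  exists2 C : R, 0 <= C & forall x, `|T x| <= C * `|x|.
Proof.
rewrite /compact_operator precompactE => /compact_bounded.
move=> /pinfty_ex_gt0[C C0 CT]; exists C; first exact: ltW.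
move=> x; have [->|x0] := eqVneq x 0; first by rewrite linear0 !normr0 mulr0.
have nx : 0 < `|x| by rewrite normr_gt0.
have : `|T (`|x|^-1 *: x)| <= C.
  apply: CT; apply: subset_closure; exists (`|x|^-1 *: x) => //=.
  by rewrite normrZ normfV normr_id mulVf// gt_eqF.
by rewrite linearZ/= normrZ normfV normr_id ler_pdivrMl// mulrC.
Qed.

Context (C : R) (C0 : 0 <= C) (TC : forall x, `|T x| <= C * `|x|).

(** The functional [f |-> <T f, g>] is bounded, so Riesz provides the vector that
    [adjoint] selects. *)
Lemma adjointP f g : dot (T f) g = dot f (adjoint T g) :> R.
Proof.
have [x|h Lh] := @riesz _ _ (dotr g \o T) (C * `|g|).
  rewrite (le_trans (cauchy_schwarz _ _))// mulrAC ler_wpM2r//.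
suff : exists h, forall f, dot (T f) g = dot f h :> R by move/getPex; exact.
by exists h.
Qed.

Lemma adjoint_bounded g : `|adjoint T g| <= C * `|g|.
Proof.
have [->|a0] := eqVneq (adjoint T g) 0; first by rewrite normr0 mulr_ge0.
have na : 0 < `|adjoint T g| by rewrite normr_gt0.
rewrite -(ler_pM2l na) -expr2 -dotxx -adjointP.
by rewrite (le_trans (dot_le_norm _ _))// mulrA ler_wpM2r// mulrC.
Qed.

Lemma adjoint_comp_itv x : 0 <= dot ((adjoint T \o T) x) x <= C ^+ 2 * `|x| ^+ 2.
Proof.
by rewrite /= dotC -adjointP dotxx sqr_ge0 -exprMn ler_sqr ?nnegrE ?mulr_ge0 ?TC.
Qed.

Lemma comp_adjoint_itv y : 0 <= dot ((T \o adjoint T) y) y <= C ^+ 2 * `|y| ^+ 2.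
Proof.
rewrite /= adjointP dotxx sqr_ge0 -exprMn ler_sqr ?nnegrE ?mulr_ge0//.
exact: adjoint_bounded.
Qed.

Lemma image_cvg (u : nat -> H) (x : H) : u @ \oo --> x -> (T \o u) @ \oo --> T x.
Proof.
by move=> ux; exact: (cvg_comp _ _ ux (@bounded_continuous _ _ _ T C TC x)).
Qed.

(** A spectral decomposition of [T^* T] determines a singular value decomposition
    [T e_i = sigma_i g_i], hence a spectral decomposition of [T T^*] with the same
    eigenvalues [sigma_i^2]. *)
Section svd.
Context (s : (nat -> R) * (nat -> H))
  (ds : spectral_decomposition (adjoint T \o T) s).

Let e := s.2.
Let oe : orthonormal0 e := spectral_orthonormal0 ds.

(** Defined from [T] rather than as the square root of [s.1 i], so that it also
    vanishes at padding indices, where [s.1 i] is arbitrary. *)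
Definition singular_value i : R := `|T (s.2 i)|.

(** Where the singular value is [0] its inverse is [0], so the vector is padding. *)
Definition left_singular i : K := (singular_value i)^-1 *: T (s.2 i).

Lemma dot_image i j : dot (T (e i)) (T (e j)) = s.1 j * dot (e i) (e j) :> R.
Proof.
by rewrite adjointP -[adjoint _ _]/((adjoint T \o T) _) (spectral_eigen _ ds) dotZr.
Qed.

Lemma singular_eigen i : e i <> 0 -> s.1 i = singular_value i ^+ 2.
Proof.
move=> ei; rewrite /singular_value -dotxx dot_image dotxx.
by case: (oe.1 i) => // ->; rewrite expr1n mulr1.
Qed.

Lemma singularE i : T (e i) = singular_value i *: left_singular i.
Proof.
rewrite /left_singular scalerA.
have [s0|s0] := eqVneq (singular_value i) 0; last by rewrite divff// scale1r.
by rewrite s0 mul0r scale0r; apply/eqP; rewrite -normr_eq0; exact/eqP.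
Qed.

Lemma image_series (c : nat -> R) n :
  T (series (fun i => c i *: e i) n) =
  series (fun i => (c i * singular_value i) *: left_singular i) n.
Proof.
rewrite /series/= linear_sum; apply: eq_bigr => i _.
by rewrite (linearZ_LR T) singularE scalerA.
Qed.

Lemma left_singular_orthonormal0 : orthonormal0 left_singular.
Proof.
split=> [i|i j ij].
  have [s0|s0] := eqVneq (singular_value i) 0.
    by left; rewrite /left_singular s0 invr0 scale0r.
  by right; rewrite /left_singular normrZ normfV normr_id mulVf.
by rewrite dotZl dotZr dot_image oe.2// !mulr0.
Qed.

Lemma calculus_series_singular (psi : R -> R) x :
  calculus_series psi s x =
  series (fun i => (psi (singular_value i ^+ 2) * dot x (e i)) *: e i).
Proof.
congr series; apply/funext => i; rewrite -/e.
have [->|/eqP e0] := eqVneq (e i) 0; first by rewrite !scaler0.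
by rewrite singular_eigen.
Qed.

(** The eigenvectors need not span [H], but what they miss lies in the kernel of
    [T]: if [p] is the projection of [x] on their span, then [T^* T (x - p) = 0],
    so [|T (x - p)|^2 = 0]. *)
Lemma image_expansion x : series (fun i => dot x (e i) *: T (e i)) @ \oo --> T x.
Proof.
have cP : cvgn (series (fun i => dot x (e i) *: e i)).
  apply: (cvg_orth_series (M := `|x| ^+ 2) oe) => n.
  apply: le_trans (bessel oe x n); apply: ler_sum => i _.
  by rewrite expr2 -mulrA dot_orthE// -expr2.
set p := limn (series (fun i => dot x (e i) *: e i)) in cP.
have TP : T p = T x.
  apply/eqP; rewrite eq_sym -subr_eq0 -linearB; apply/eqP/dotxx_eq0.
  rewrite adjointP -[adjoint _ _]/((adjoint T \o T) _).
  suff -> : (adjoint T \o T) (x - p) = 0 by rewrite dot0r.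
  case: (ds) => _ _ /(_ (x - p)) h; apply: (cvg_unique _ h) => //.
  apply: cvg_near_cst; apply: nearW => n; rewrite /series/= big1// => i _.
  by rewrite dotBl (dot_orth_lim oe i cP) dot_orthE// subrr mulr0 scale0r.
rewrite -TP; rewrite (_ : series _ = T \o series (fun i => dot x (e i) *: e i)).
  exact: image_cvg.
apply/funext => n; rewrite /series/= linear_sum.
by apply: eq_bigr => i _; rewrite linearZ.
Qed.

(** [image_expansion] at [T^* y], since [<T^* y, e_i> T e_i] equals
    [sigma_i^2 <y, g_i> g_i] when [T e_i = sigma_i g_i]. *)
Lemma spectral_decomposition_swap : spectral_decomposition (T \o adjoint T)
  (fun i => singular_value i ^+ 2, left_singular).
Proof.
case: left_singular_orthonormal0 => n o; split => // y /=.
rewrite (_ : (fun i => _) = fun i => dot (adjoint T y) (e i) *: T (e i)).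
  exact: image_expansion.
apply/funext => i; rewrite [dot (adjoint T y) _]dotC -adjointP singularE dotZl.
rewrite scalerA (dotC y).
by congr (_ *: _); ring.
Qed.

End svd.

(** If [f = phi(T^* T) w] then [T f = Theta(T T^* ) v], where the
    coefficients of [v] along the [g_i] are those of [w] along the [e_i]: both sides
    are
    [\sum_i phi(sigma_i^2) sigma_i <w, e_i> g_i]. *)
Lemma source_set_image (phi : R -> R) (phi0 : phi 0 = 0)
    (phi_homo : {in `[0, +oo[ &, {homo phi : u v / u <= v}}) f :
  source_set phi (adjoint T \o T) f ->
  source_set (Theta phi) (T \o adjoint T) (T f).
Proof.
have Theta0 : Theta phi 0 = 0 by rewrite /Theta sqrtr0 mul0r.
have Theta_homo := Theta_nondecreasing phi0 phi_homo.
have CC : 0 <= C ^+ 2 := sqr_ge0 C.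
move=> [w /= w1 <-].
have [[s ds]|nd] := pselect (exists s, spectral_decomposition (adjoint T \o T) s);
  last first.
  rewrite spectral_calculus_default// linear0; exists 0; first by rewrite /= normr0.
  exact: spectral_calculus0.
have oe := spectral_orthonormal0 ds.
have dt := spectral_decomposition_swap ds.
have og := left_singular_orthonormal0 ds.
set g := left_singular s in dt og.
have cf := calculus_series_cvg CC adjoint_comp_itv phi0 phi_homo (x := w) ds.
rewrite (spectral_calculusE CC adjoint_comp_itv phi0 phi_homo ds cf).
set h := limn _ in cf *.
have gw n : \sum_(0 <= i < n) dot w (s.2 i) ^+ 2 * `|g i| ^+ 2 <= 1 :> R.
  apply: (@le_trans _ _ (`|w| ^+ 2)); last by rewrite expr_le1.
  apply: le_trans (bessel oe w n); apply: ler_sum => i _.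
  by case: (og.1 i) => ->; rewrite ?normr0 ?expr1n ?mulr1// expr0n/= mulr0 sqr_ge0.
have cw := cvg_orth_series og gw.
set v := limn _ in cw.
(* By Bessel, v is no longer than w. *)
exists v.
  apply: (cvg_norm_le cw) => n.
  by rewrite -(ler_sqr) ?nnegrE// expr1n sqr_norm_orth_sum// gw.
apply: (spectral_calculusE CC comp_adjoint_itv Theta0 Theta_homo dt).
rewrite (_ : calculus_series _ _ _ = T \o calculus_series phi s w);
  first exact: image_cvg.
rewrite (calculus_series_singular ds).
apply/funext => n; rewrite [RHS]image_series.
apply: eq_bigr => i _; rewrite (dot_orth_lim og i cw).
have sg : 0 <= singular_value s i by exact: normr_ge0.
rewrite /Theta /= sqrtr_sqr (ger0_norm sg) {sg}.
rewrite -/g; case: (og.1 i) => ->; first by rewrite !scaler0.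
by rewrite expr1n; congr (_ *: _); ring.
Qed.

End compact_operator.

(** * Jensen's inequality on the half-line *)

Section concavity.
Context (R : realType) (F : R -> R) (F_concave : concave_on_nonneg F).

Lemma concave_on_nonneg_conv (a x y : R) : 0 <= x -> 0 <= y -> 0 <= a <= 1 ->
  a * F x + (1 - a) * F y <= F (a * x + (1 - a) * y).
Proof.
move=> x0 y0 /andP[a0 a1].
have := F_concave (Itv01 a0 a1) (x := x) (y := y).
rewrite !inE/= !in_itv/= !andbT => /(_ x0 y0).
by rewrite !convRE/= !mulrN -opprD lerN2.
Qed.

(** Concavity with unnormalised weights.  The weighted mean is given by an
    equation without division, so that the statement survives total weight [0]
    and can be iterated. *)
Lemma concave_on_nonneg_weighted (a b x y : R) :
  0 <= a -> 0 <= b -> 0 <= x -> 0 <= y ->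
  exists2 m, 0 <= m & a * x + b * y = (a + b) * m /\
    a * F x + b * F y <= (a + b) * F m.
Proof.
move=> a0 b0 x0 y0; have [ab0|ab0] := eqVneq (a + b) 0.
  have a0' : a = 0 by lra.
  have b0' : b = 0 by lra.
  by exists 0 => //; rewrite a0' b0' !mul0r addr0 !mul0r.
have ab : 0 < a + b by rewrite lt_neqAle eq_sym ab0 addr_ge0.
have e : b / (a + b) = 1 - a / (a + b) by field.
exists (a / (a + b) * x + (1 - a / (a + b)) * y).
  by rewrite -e addr_ge0// mulr_ge0// divr_ge0// ltW.
split; first by field.
have t01 : 0 <= a / (a + b) <= 1.
  by rewrite divr_ge0 ?(ltW ab)//= ler_pdivrMr// mul1r lerDl.
have := concave_on_nonneg_conv x0 y0 t01; rewrite -(ler_pM2l ab).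
apply: le_trans; rewrite le_eqVlt; apply/orP; left; apply/eqP; field => //.
Qed.

(** Weights of total mass at most [1] suffice: the missing mass is put at [0],
    where [F] is nonnegative. *)
Lemma jensen_nonneg (p u : nat -> R) n : 0 <= F 0 ->
  (forall i, 0 <= p i) -> (forall i, 0 <= u i) -> \sum_(0 <= i < n) p i <= 1 ->
  \sum_(0 <= i < n) p i * F (u i) <= F (\sum_(0 <= i < n) p i * u i).
Proof.
move=> F0 p0 u0 p1.
have [m m0 [-> /le_trans]] : exists2 m, 0 <= m &
    \sum_(0 <= i < n) p i * u i = (\sum_(0 <= i < n) p i) * m /\
    \sum_(0 <= i < n) p i * F (u i) <= (\sum_(0 <= i < n) p i) * F m.
  elim: n {p1} => [|n [m m0 [Em Fm]]].
    by exists 0 => //; rewrite !big_geq// !mul0r.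
  rewrite !big_nat_recr//= Em.
  set P := \sum_(0 <= i < n) p i in Fm *.
  have P0 : 0 <= P by rewrite sumr_ge0.
  have [k k0 [Ek Fk]] := concave_on_nonneg_weighted P0 (p0 n) m0 (u0 n).
  by exists k => //; split => //; apply: le_trans Fk; rewrite lerD2r.
apply.
set P := \sum_(0 <= i < n) p i in p1 *.
have P01 : 0 <= P <= 1 by rewrite p1 sumr_ge0.
have := concave_on_nonneg_conv m0 (lexx 0) P01.
rewrite mulr0 addr0; apply: le_trans; rewrite lerDl mulr_ge0// subr_ge0.
exact: p1.
Qed.

End concavity.

(** * Index functions and the smoothness modulus *)

Lemma inv_on_nonnegK (R : realType) (F : R -> R) (u : R) :
  {in `[0, +oo[ &, {homo F : x y / x < y}} -> 0 <= u -> inv_on_nonneg F (F u) = u.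
Proof.
move=> F_homo u0; rewrite /inv_on_nonneg pinvKV//; last first.
  by rewrite inE/= in_itv/= u0.
move=> x y; rewrite !inE/= => x0 y0 Fxy.
by case: (ltgtP x y) => // xy;
  [have := F_homo _ _ x0 y0 xy|have := F_homo _ _ y0 x0 xy];
  rewrite Fxy ltxx.
Qed.

Section index_function.
Context (R : realType) (phi : R -> R) (phi_index : index_function phi).

Lemma index_function_nondecreasing : {in `[0, +oo[ &, {homo phi : u v / u <= v}}.
Proof. by case: phi_index. Qed.

Lemma index_function0 : phi 0 = 0. Proof. by case: phi_index. Qed.

Lemma Theta_homo : {in `[0, +oo[ &, {homo Theta phi : u v / u < v}}.
Proof.
move=> u v u0 v0 uv; have [_ phi_homo _ phi_gt0] := phi_index.
have v_gt0 : 0 < v by apply: le_lt_trans uv; move: u0; rewrite in_itv/= andbT.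
apply: (@le_lt_trans _ _ (Num.sqrt u * phi v)).
  by rewrite ler_wpM2l ?sqrtr_ge0// phi_homo// ltW.
by rewrite ltr_pM2r ?phi_gt0// ltr_sqrt.
Qed.

Lemma Theta_ge0 u : 0 <= u -> 0 <= Theta phi u.
Proof.
move=> u0; rewrite mulr_ge0 ?sqrtr_ge0//.
exact: nondecreasing0_ge0 index_function0 index_function_nondecreasing _ u0.
Qed.

(** [Theta] is unbounded because [Theta u >= sqrt u * phi 1] for [u >= 1]; the
    intermediate value theorem does the rest.  Every level [r >= 0] can thus be
    written [Theta u], which turns facts about [Theta^-1] into facts about
    [phi]. *)
Lemma Theta_surj r : 0 <= r -> exists2 u, 0 <= u & Theta phi u = r.
Proof.
move=> r0; have [phi_cont phi_homo phi0 phi_gt0] := phi_index.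
pose q := r / phi 1; pose b := 1 + q ^+ 2.
have q0 : 0 <= q by rewrite divr_ge0// ltW// phi_gt0.
have b1 : 1 <= b by rewrite lerDl sqr_ge0.
have b0 : 0 <= b by rewrite (le_trans _ b1).
have rb : r <= Theta phi b.
  rewrite -[r](divfK (_ : phi 1 != 0)) ?gt_eqF ?phi_gt0//.
  apply: ler_pM => //; first by rewrite ltW// phi_gt0.
    by rewrite -/q -(ger0_norm q0) -sqrtr_sqr ler_wsqrtr// lerDr.
  by rewrite phi_homo// in_itv/= andbT.
have [||u] := @IVT R (Theta phi) 0 b r b0.
- apply: (continuous_subspaceW _
    (_ : {within `[0, +oo[, continuous (Theta phi)})).
    by move=> x /=; rewrite !in_itv/= => /andP[->].
  move=> x; apply: continuousM; last exact: phi_cont.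
  by apply: continuous_subspaceT; exact: sqrt_continuous.
- by rewrite {1}/Theta sqrtr0 mul0r ge_min le_max r0 rb orbT.
by rewrite in_itv/= => /andP[u0 _ <-]; exists u.
Qed.

(** It bounds the norm of a signal in the source set in terms of the norm of its
    image under the operator ([source_norm_le]). *)
Definition smoothness_modulus r := phi (inv_on_nonneg (Theta phi) r).
Local Notation G := smoothness_modulus.

Lemma smoothness_modulusE u : 0 <= u -> G (Theta phi u) = phi u.
Proof. by move=> u0; rewrite /G inv_on_nonnegK//; exact: Theta_homo. Qed.

Lemma smoothness_modulus_ge0 r : 0 <= r -> 0 <= G r.
Proof.
move=> /Theta_surj[u u0 <-]; rewrite smoothness_modulusE//.
exact: nondecreasing0_ge0 index_function0 index_function_nondecreasing _ u0.
Qed.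

Lemma smoothness_modulus_homo : {in `[0, +oo[ &, {homo G : r s / r <= s}}.
Proof.
move=> r s; rewrite !in_itv/= !andbT => /Theta_surj[u u0 <-] /Theta_surj[v v0 <-] uv.
rewrite !smoothness_modulusE//.
apply: index_function_nondecreasing; rewrite ?in_itv/= ?andbT//.
rewrite leNgt; apply/negP => vu; move: uv; rewrite leNgt => /negP; apply.
by apply: Theta_homo; rewrite ?in_itv/= ?andbT.
Qed.

(** Right continuity, which the passage to the infimum over tests requires. *)
Lemma smoothness_modulus_right r (eps : R) : 0 <= r -> 0 < eps ->
  exists2 r', r < r' & G r' <= G r + eps.
Proof.
move=> /Theta_surj[u u0 <-] e0.
have [phi_cont phi_homo phi0 phi_gt0] := phi_index.
have [v uv vle] : exists2 v, u < v & phi v <= phi u + eps.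
  have cr : phi x @[x --> u^'+] --> phi u.
    have /continuous_within_itvcyP[ci c0] := phi_cont.
    have [->//|u1] := eqVneq u 0.
    apply: cvg_at_right_filter; apply: ci.
    by rewrite in_itv/= andbT lt_neqAle eq_sym u1.
  near u^'+ => v; exists v; first by near: v; exact: nbhs_right_gt.
  by near: v; apply: cvgr_le cr _ _; rewrite ltrDl.
have v0 : 0 <= v by rewrite (le_trans u0)// ltW.
exists (Theta phi v).
  by apply: Theta_homo; rewrite ?in_itv/= ?andbT.
by rewrite !smoothness_modulusE.
Unshelve. all: by end_near. Qed.

(** The function assumed concave is [u |-> G (sqrt u) ^ 2], with [G] the
    smoothness modulus. *)
Lemma sqr_smoothness_modulus r : 0 <= r ->
  phi (inv_on_nonneg (fun v => Theta phi v ^+ 2) (r ^+ 2)) ^+ 2 = G r ^+ 2.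
Proof.
move=> /Theta_surj[u u0 <-]; rewrite smoothness_modulusE//.
rewrite (@inv_on_nonnegK _ (fun v => Theta phi v ^+ 2))//.
move=> x y; rewrite !in_itv/= !andbT => x0 y0 xy.
rewrite ltr_sqr ?nnegrE ?Theta_ge0//.
by apply: Theta_homo; rewrite ?in_itv/= ?andbT.
Qed.

End index_function.

(** * Signal norm against image norm *)

Section interpolation.
Context (R : realType) (H K : hilbertType R) (T : {linear H -> K}).
Context (C : R) (C0 : 0 <= C) (TC : forall x, `|T x| <= C * `|x|).
Context (phi : R -> R) (phi_index : index_function phi)
  (phi_concave : concave_on_nonneg
     (fun u => phi (inv_on_nonneg (fun v => Theta phi v ^+ 2) u) ^+ 2)).

(** With [p_i = <w, e_i>^2] and [q_i = Theta(sigma_i^2)^2], the squared norm of a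
    partial sum is [\sum_i p_i phi(sigma_i^2)^2] and that of its image is
    [\sum_i p_i q_i].  Since [phi(sigma_i^2)^2] is the concave function of the
    hypothesis at [q_i], Jensen compares the two. *)
Lemma partial_source_norm_le s w n : spectral_decomposition (adjoint T \o T) s ->
  `|w| <= 1 -> `|calculus_series phi s w n| <=
    smoothness_modulus phi `|T (calculus_series phi s w n)|.
Proof.
move=> ds w1; have os := spectral_orthonormal0 ds.
rewrite -ler_sqr ?nnegrE ?smoothness_modulus_ge0//.
rewrite -sqr_smoothness_modulus// (calculus_series_singular TC ds).
pose p i := dot w (s.2 i) ^+ 2 : R.
pose q i := Theta phi (singular_value T s i ^+ 2) ^+ 2.
have normS : `|series (fun i =>
    (phi (singular_value T s i ^+ 2) * dot w (s.2 i)) *: s.2 i) n| ^+ 2 =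
    \sum_(0 <= i < n) p i *
      phi (inv_on_nonneg (fun v => Theta phi v ^+ 2) (q i)) ^+ 2.
  rewrite (sqr_norm_orth_sum os); apply: eq_bigr => i _.
  rewrite sqr_smoothness_modulus ?Theta_ge0 ?sqr_ge0//.
  rewrite smoothness_modulusE ?sqr_ge0// exprMn mulrC /p -[in RHS]dot_orthE//.
  by case: (os.1 i) => ->; rewrite ?normr0 ?normr1; ring.
have normTS : `|T (series (fun i =>
    (phi (singular_value T s i ^+ 2) * dot w (s.2 i)) *: s.2 i) n)| ^+ 2 =
    \sum_(0 <= i < n) p i * q i.
  rewrite image_series (sqr_norm_orth_sum (left_singular_orthonormal0 TC ds)).
  apply: eq_bigr => i _; rewrite /p /q /Theta.
  have sg : 0 <= singular_value T s i by exact: normr_ge0.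
  have sn : singular_value T s i ^+ 2 * `|left_singular T s i| ^+ 2 =
      singular_value T s i ^+ 2.
    by rewrite -exprMn -{1}(ger0_norm sg) -normrZ -singularE.
  rewrite sqrtr_sqr (ger0_norm sg).
  by rewrite exprMn -mulrA sn; ring.
rewrite normS normTS; apply: (jensen_nonneg phi_concave).
- by rewrite sqr_ge0.
- by move=> i; exact: sqr_ge0.
- by move=> i; exact: sqr_ge0.
- by rewrite (le_trans (bessel os w n))// expr_le1.
Qed.

(** The images of the eigenvectors are orthogonal, so the norms of the images of
    the partial sums increase. *)
Lemma image_partial_norm_le s w f n : spectral_decomposition (adjoint T \o T) s ->
  calculus_series phi s w @ \oo --> f ->
  `|T (calculus_series phi s w n)| <= `|T f|.
Proof.
move=> ds sf.
apply: (cvgr_to_ge (cvg_norm (image_cvg TC sf))).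
near=> m; have nm : (n <= m)%N by near: m; exact: nbhs_infty_ge.
rewrite /= -ler_sqr ?nnegrE// !image_series.
rewrite !(sqr_norm_orth_sum (left_singular_orthonormal0 TC ds)).
rewrite (big_cat_nat (leq0n n) nm)//= lerDl sumr_ge0// => i _.
by rewrite mulr_ge0 ?sqr_ge0.
Unshelve. all: by end_near. Qed.

Lemma source_norm_le f : source_set phi (adjoint T \o T) f ->
  `|f| <= smoothness_modulus phi `|T f|.
Proof.
have phi0 := index_function0 phi_index.
have phi_homo := index_function_nondecreasing phi_index.
move=> [w /= w1 <-].
have [[s ds]|nd] := pselect (exists s, spectral_decomposition (adjoint T \o T) s);
  last first.
  by rewrite spectral_calculus_default// normr0 smoothness_modulus_ge0.
have cf := calculus_series_cvg (sqr_ge0 C) (adjoint_comp_itv C0 TC) phi0 phi_homo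
  (x := w) ds.
rewrite (spectral_calculusE (sqr_ge0 C) (adjoint_comp_itv C0 TC) phi0 phi_homo
  ds cf).
apply: (cvg_norm_le cf) => n.
apply: le_trans (partial_source_norm_le n ds w1) _.
apply: smoothness_modulus_homo => //; rewrite ?in_itv/= ?andbT//.
exact: image_partial_norm_le.
Qed.

End interpolation.

(** * Separation rates *)

Section testing.
Context (R : realType) (H K : hilbertType R) (T : {linear H -> K}) (sigma : R)
  (d : measure_display) (Omega : measurableType d) (P : probability Omega R)
  (xi : K -> {RV P >-> R}).
Implicit Types (Phi : test K) (f : H).
Local Notation acc := (acceptance_prob T sigma xi).

Lemma measurable_observation f :
  measurable_fun setT (observation T sigma xi f : Omega -> data K).
Proof.
apply: (@measurability _ _ Omega (data K) setT (observation T sigma xi f)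
  (@cylinders R K)) => //.
move=> _ [_ [g [B [mB ->]]] <-].
have mg : measurable_fun setT (fun omega => dot (T f) g + sigma * xi g omega).
  by apply: measurable_funD => //; apply: measurable_funM.
by have := mg measurableT B mB.
Qed.

Lemma acceptance_prob_itv Phi f : 0 <= acc Phi f <= 1.
Proof.
have mA : measurable (observation T sigma xi f @^-1` [set y | Phi y = false]).
  rewrite -[X in measurable X]setTI; apply: measurable_observation => //.
  exact: (@measurable_funPTI _ _ _ _ Phi [set false]).
rewrite /acceptance_prob /law /pushforward fine_ge0//=.
by rewrite -lee_fin fineK ?fin_num_measure// probability_le1.
Qed.

Lemma acceptance_prob_le_sup Phi (S : set H) f :
  S f -> acc Phi f <= sup [set acc Phi h | h in S].
Proof.
move=> Sf; apply: ub_le_sup; last by exists f.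
by exists 1 => _ [h _ <-]; case/andP: (acceptance_prob_itv Phi h).
Qed.

(** [0 <= beta] covers the empty set, whose [sup] is [0]. *)
Lemma sup_acceptance_prob_le Phi (S : set H) (beta : R) : 0 <= beta ->
  (forall f, S f -> acc Phi f <= beta) -> sup [set acc Phi h | h in S] <= beta.
Proof.
move=> b0 Sb; have [->|/set0P[f Sf]] := eqVneq S set0.
  by rewrite image_set0 sup0.
by apply: ge_sup; [exists (acc Phi f), f|move=> _ [h Sh <-]; exact: Sb].
Qed.

Lemma inf_ge0 (S : set R) : (forall x, S x -> 0 <= x) -> 0 <= inf S.
Proof.
move=> S0; have [->|/set0P S1] := eqVneq S set0; first by rewrite inf0.
exact: lb_le_inf.
Qed.

Lemma rateI_ge0 (E : set H) (beta : R) Phi : 0 <= rateI T sigma xi E beta Phi.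
Proof. by apply: inf_ge0 => rho []. Qed.

Lemma rateD_ge0 (E : set K) (beta : R) Phi : 0 <= rateD T sigma xi E beta Phi.
Proof. by apply: inf_ge0 => rho []. Qed.

Section transfer.
Context (EI : set H) (ED : set K) (beta : R) (beta0 : 0 <= beta).

(** The infimum defining the direct rate is attained: a signal whose image is
    longer than the infimum is already longer than some admissible [rho].
    Boundedness of the alternative makes large [rho] admissible; with no
    admissible [rho] the infimum would be the default [0]. *)
Lemma rateD_acceptance (M : R) Phi f : 0 <= M -> (forall y, ED y -> `|y| <= M) ->
  ED (T f) -> rateD T sigma xi ED beta Phi < `|T f| -> acc Phi f <= beta.
Proof.
move=> M0 EM Ef; rewrite /rateD => /inf_lt[|rho [rho0 supb] rhof].
  exists M; split => //; apply: sup_acceptance_prob_le => // h [/EM hM].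
  by rewrite ltNge hM.
by apply: le_trans supb; apply: acceptance_prob_le_sup.
Qed.

Lemma rateI_le (rho : R) Phi : 0 <= rho ->
  (forall f, EI f -> rho < `|f| -> acc Phi f <= beta) ->
  rateI T sigma xi EI beta Phi <= rho.
Proof.
move=> rho0 EIb; apply: ge_inf; first by exists 0 => r [].
by split => //; apply: sup_acceptance_prob_le => // f []; exact: EIb.
Qed.

Context (M : R) (M0 : 0 <= M) (ED_bounded : forall y, ED y -> `|y| <= M).
Context (G : R -> R) (G_ge0 : forall r, 0 <= r -> 0 <= G r)
  (G_homo : {in `[0, +oo[ &, {homo G : r s / r <= s}})
  (G_right : forall r eps, 0 <= r -> 0 < eps ->
     exists2 r', r < r' & G r' <= G r + eps).
Context (EI_ED : forall f, EI f -> ED (T f))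
  (EI_G : forall f, EI f -> `|f| <= G `|T f|).

(** As [|f| <= G |T f|] with [G] nondecreasing, a signal longer than [G rho] has an
    image longer than [rho]; a test that detects such images detects such signals. *)
Lemma rateI_le_rateD Phi :
  rateI T sigma xi EI beta Phi <= G (rateD T sigma xi ED beta Phi).
Proof.
have r0 := rateD_ge0 ED beta Phi.
apply: rateI_le; first exact: G_ge0.
move=> f Ef Gf; apply: (rateD_acceptance M0) => //; first exact: EI_ED.
rewrite ltNge; apply/negP => Tf; move: Gf; apply/negP; rewrite -leNgt.
apply: le_trans (EI_G Ef) _.
by apply: G_homo; rewrite ?in_itv/= ?andbT.
Qed.

Lemma levelD_levelI (alpha : R) Phi :
  levelD T sigma xi alpha Phi -> levelI T sigma xi alpha Phi.
Proof. by move=> lD f f0; apply: lD; rewrite f0 linear0. Qed.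

(** Right continuity of [G] at the direct minimax rate gives [r'] above it with
    [G r'] within [eps]; some test has direct rate below [r'].  The test that never
    rejects shows that the infimum is over a nonempty set. *)
Lemma minimaxI_le_minimaxD (alpha : R) : 0 <= alpha ->
  minimaxI T sigma xi EI alpha beta <= G (minimaxD T sigma xi ED alpha beta).
Proof.
move=> alpha0.
have m0 : 0 <= minimaxD T sigma xi ED alpha beta.
  by apply: inf_ge0 => _ [Phi _ <-]; exact: rateD_ge0.
apply/ler_addgt0Pr => eps eps0.
have [r' mr' Gr'] := G_right m0 eps0; apply: le_trans Gr'.
have [|_ [Phi lD <-] Phir'] := inf_lt _ mr'.
  exists (rateD T sigma xi ED beta (cst false : test K)), (cst false : test K) => //.
  move=> f _; rewrite /rejection_prob /law /pushforward.
  rewrite (_ : _ @^-1` _ = set0) ?measure0// -subset0 => omega.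
  by [].
apply: (@le_trans _ _ (rateI T sigma xi EI beta Phi)).
  apply: ge_inf; first by exists 0 => _ [Psi _ <-]; exact: rateI_ge0.
  by exists Phi => //; exact: levelD_levelI.
apply: le_trans (rateI_le_rateD Phi) _.
have r0 := rateD_ge0 ED beta Phi.
by apply: G_homo; rewrite ?in_itv/= ?andbT// ltW// (le_lt_trans r0).
Qed.

End transfer.
End testing.

Theorem theorem4p1 (R : realType) (H K : hilbertType R)
    (sepH : separable H) (sepK : separable K)
    (T : {linear H -> K}) (compactT : compact_operator T)
    (sigma : R) (sigma_gt0 : 0 < sigma)
    (d : measure_display) (Omega : measurableType d) (P : probability Omega R)
    (xi : K -> {RV P >-> R}) (xi_noise : white_noise xi)
    (phi : R -> R) (phi_index : index_function phi)
    (phi_concave : concave_on_nonneg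
       (fun u => phi (inv_on_nonneg (fun v => Theta phi v ^+ 2) u) ^+ 2))
    (alpha beta : R) (alpha01 : 0 < alpha < 1) (beta01 : 0 < beta < 1) :
  let E_phi := source_set phi (adjoint T \o T) in
  let E_Theta := source_set (Theta phi) (T \o adjoint T) in
  (forall Phi : test K,
     levelD T sigma xi alpha Phi ->
     levelI T sigma xi alpha Phi /\
     rateI T sigma xi E_phi beta Phi <=
       phi (inv_on_nonneg (Theta phi) (rateD T sigma xi E_Theta beta Phi))) /\
  minimaxI T sigma xi E_phi alpha beta <=
    phi (inv_on_nonneg (Theta phi) (minimaxD T sigma xi E_Theta alpha beta)).
Proof.
move=> E_phi E_Theta.
have [C C0 TC] := compact_operator_bounded compactT.
have phi0 := index_function0 phi_index.
have phi_homo := index_function_nondecreasing phi_index.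
have beta0 : 0 <= beta by case/andP: beta01 => /ltW.
have alpha0 : 0 <= alpha by case/andP: alpha01 => /ltW.
have Theta0 : Theta phi 0 = 0 by rewrite /Theta sqrtr0 mul0r.
have M0 := Theta_ge0 phi_index (sqr_ge0 C).
have E_Theta_bounded y : E_Theta y -> `|y| <= Theta phi (C ^+ 2).
  apply: (source_set_bounded (sqr_ge0 C) (comp_adjoint_itv C0 TC) Theta0).
  exact: Theta_nondecreasing.
have G_ge0 := smoothness_modulus_ge0 phi_index.
have G_homo := smoothness_modulus_homo phi_index.
have G_right := smoothness_modulus_right phi_index.
have E_image := source_set_image C0 TC phi0 phi_homo.
have E_norm := source_norm_le C0 TC phi_index phi_concave.
split=> [Phi lD|].
  split; first exact: levelD_levelI lD.
  exact: (rateI_le_rateD sigma xi beta0 M0 E_Theta_bounded G_ge0 G_homo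
    E_image E_norm).
exact: (minimaxI_le_minimaxD sigma xi beta0 M0 E_Theta_bounded G_ge0 G_homo G_right
  E_image E_norm alpha0).
Qed.
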